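(* Let $0<\alpha<1$ and let $d\geq 1$ be an integer. There exists $N_0(\alpha,d)$ such that for every integer $N\geq N_0(\alpha,d)$, every subset $A\subseteq\{1,\dots,N\}$ of size $\alpha N$ contains a non-trivial $d$-configuration.
   Context: A $d$-configuration is a set of the form $\{n_i+n_j+a\}_{1\leq i\leq j\leq d}$ with $a,n_1,\dots,n_d\in\mathbb{N}$. It is non-trivial if $n_i\neq n_j$ for all $i\neq j$. A set $A$ contains the configuration if all of the numbers $n_i+n_j+a$ ($1\le i\le j\le d$) lie in $A$. *)

(* Defs.v *)
From mathcomp Require Import all_boot all_order all_algebra.
From mathcomp Require Import finmap.
From mathcomp Require Import reals.

Set Implicit Arguments.
Unset Strict Implicit.
Unset Printing Implicit Defensive.

Local Open Scope fset_scope.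

Definition configuration (d : nat) (a : nat) (n : 'I_d -> nat) : {fset nat} :=
  [fset n p.1 + n p.2 + a | p in [pred p : 'I_d * 'I_d | p.1 <= p.2]]%N.

(* The natural numbers of a configuration are taken to be positive. Since a
   configuration with positive parameters is also one with nonnegative
   parameters, containing one in this sense is the stronger property. *)
Definition contains_nontrivial_configuration (d : nat) (A : {fset nat}) : Prop :=
  exists (a : nat) (n : 'I_d -> nat),
    [/\ (0 < a)%N, (forall i, (0 < n i)%N), injective n
      & configuration a n `<=` A].

(* Main.v *)
(** A configuration n_1 < ... < n_d is built one parameter at a time from Roth's theorem.
    By Roth and pigeonhole, a dense A has some r > 0 for which the set A_r of those t with
    t, t + r, t + 2 r in A is again dense; if A_r contains the configuration (a, n_1, ..., n_d),
    then A contains (a, n_1, ..., n_d, n_d + r).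

    Roth's theorem is proved with Szemeredi's Hilbert cube argument, as a density increment
    in steps of 1 / (64 q^2) down to density 1 / q. *)

Require Import Defs.
From mathcomp Require Import all_boot all_order all_algebra.
From mathcomp Require Import finmap.
From mathcomp Require Import reals.
From mathcomp Require Import zify.

Import Order.TTheory GRing.Theory Num.Theory.

Set Implicit Arguments.
Unset Strict Implicit.
Unset Printing Implicit Defensive.

(** * Counting the elements of a set below a bound *)

Definition cnt (A : pred nat) (n : nat) : nat := \sum_(i < n) A i.

Definition supported (A : pred nat) (n : nat) : Prop := forall i, A i -> i < n.

Lemma cntD (A : pred nat) m n : cnt A (m + n) = cnt A m + cnt (fun i => A (m + i)) n.
Proof. by rewrite /cnt big_split_ord. Qed.

Lemma cnt_le_size (A : pred nat) n : cnt A n <= n.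
Proof.
apply: leq_trans (_ : \sum_(i < n) 1 <= n); last by rewrite sum1_card card_ord.
by apply: leq_sum => i _; apply: leq_b1.
Qed.

Lemma sub_cnt (A B : pred nat) n : (forall i, i < n -> A i -> B i) -> cnt A n <= cnt B n.
Proof.
move=> sAB; apply: leq_sum => i _.
by case: (boolP (A i)) => // Ai; rewrite (sAB i).
Qed.

Lemma cnt_supported (A : pred nat) m n : supported A m -> m <= n -> cnt A n = cnt A m.
Proof.
move=> sA le_mn; rewrite -(subnKC le_mn) cntD /cnt [X in _ + X]big1 ?addn0 // => i _.
by apply/eqP; rewrite eqb0; apply/negP => /sA; lia.
Qed.

(** The factor [s <= y] discards the indices at which [y - s] would be truncated to 0; the
    hypothesis discards the values of [f] that the shift pushes past [n]. *)
Lemma sum_shift (f : nat -> nat) s n : (forall z, n <= z + s -> f z = 0) ->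
  \sum_(y < n) (s <= y) * f (y - s) = \sum_(z < n) f z.
Proof.
move=> f0; case: (leqP s n) => [le_sn|lt_ns]; last first.
  by rewrite !big1 // => i _; [rewrite f0 //; lia | case: leqP => //; have := ltn_ord i; lia].
have -> : \sum_(y < n) (s <= y) * f (y - s) =
    \sum_(y < s + (n - s)) (s <= y) * f (y - s) by rewrite subnKC.
have -> : \sum_(z < n) f z = \sum_(z < (n - s) + s) f z by rewrite subnK.
rewrite !big_split_ord /= big1 => [|i _]; last by rewrite leqNgt ltn_ord.
rewrite [X in _ = _ + X]big1 => [|i _]; last by rewrite f0 //; lia.
by rewrite add0n addn0; apply: eq_bigr => i _; rewrite leq_addr addKn mul1n.
Qed.

Lemma cnt_shift_le (A : pred nat) s n : supported A n -> cnt (fun z => A (z + s)) n <= cnt A n.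
Proof.
move=> sA; rewrite /cnt -(@sum_shift (fun z => A (z + s)) s) => [|z le_n]; last first.
  by apply/eqP; rewrite eqb0; apply/negP => /sA; lia.
by apply: leq_sum => y _; case: (leqP s y) => //= le_sy; rewrite subnK // mul1n.
Qed.

(** * Counting along windows of a progression *)

Definition ends (C : pred nat) (r : nat) : pred nat := fun z => C z && ~~ C (z + r).

(* Average the hypothesis over the windows z, z + r, ..., z + (L - 1) r lying in C:
   all but at most L * cnt (ends C r) n elements of C start such a window. *)
Lemma window_bound (A C : pred nat) (K m L r n : nat) : 0 < L ->
  (forall z, K * cnt (fun i => A (z + i * r)) L <= m * L) -> supported C n ->
  K * cnt (predI A C) n <= m * cnt C n + K * L * cnt (ends C r) n.
Proof.
move=> L0 hA sC.
have Lsum x : L * x = \sum_(i < L) x by rewrite sum_nat_const card_ord.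
pose D := fun z => all (fun i => C (z + i * r)) (iota 0 L).
have DC z i : i < L -> D z -> C (z + i * r).
  by move=> iL /allP /(_ i); rewrite mem_iota; apply.
have cDC : cnt D n <= cnt C n.
  by apply: sub_cnt => z _ /(DC z 0 L0); rewrite mul0n addn0.
(* The translate of [D] by [i * r] lies in [C], so at most [cnt C n - cnt D n] elements of [A] in
   [C] lie outside it. *)
have step i : i < L -> cnt (predI A C) n + cnt D n <=
    \sum_(z < n) D z * A (z + i * r) + cnt C n.
  move=> iL; rewrite /cnt.
  have D0 z : n <= z + i * r -> D z = false.
    by move=> le_n; apply/negP => /(DC z i iL) /sC; lia.
  rewrite -(@sum_shift (fun z => nat_of_bool (D z)) (i * r)) => [|z /D0 -> //].
  rewrite -(@sum_shift (fun z => D z * A (z + i * r)) (i * r)) => [|z /D0 -> //].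
  rewrite -!big_split /=; apply: leq_sum => y _.
  case: (leqP (i * r) y) => [le_y|_]; last first.
    by rewrite !mul0n !addn0 add0n; case: (A y).
  rewrite subnK // !mul1n; case: (boolP (D _)) => [/(DC _ i iL)|_].
    by rewrite subnK // => ->; case: (A y).
  by case: (A y); case: (C y).
have sumstep : L * (cnt (predI A C) n + cnt D n) <=
    \sum_(z < n) D z * cnt (fun i => A (z + i * r)) L + L * cnt C n.
  have -> : \sum_(z < n) D z * cnt (fun i => A (z + i * r)) L =
      \sum_(i < L) \sum_(z < n) D z * A (z + i * r).
    by rewrite exchange_big; apply: eq_bigr => z _; rewrite /cnt big_distrr.
  rewrite !Lsum -[X in _ <= X]big_split /=.
  by apply: leq_sum => i _; apply: step.
have hD : K * \sum_(z < n) D z * cnt (fun i => A (z + i * r)) L <= m * L * cnt D n.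
  rewrite /cnt !big_distrr /=; apply: leq_sum => z _.
  by rewrite mulnCA mulnC leq_mul2r hA orbT.
have hE : cnt C n <= cnt D n + L * cnt (ends C r) n.
  rewrite Lsum.
  have sE : supported (ends C r) n by move=> i /andP[/sC].
  apply: leq_trans (_ : cnt D n + \sum_(i < L) cnt (fun z => ends C r (z + i * r)) n <= _).
    rewrite /cnt exchange_big -big_split; apply: leq_sum => z _ /=.
    case Cz: (C z) => //; case: (boolP (D z)) => [//|nD].
    have [i iL nC] : exists2 i, i < L & ~~ C (z + i * r).
      by case/allPn: nD => i; rewrite mem_iota => /andP[_ iL] nC; exists i.
    have exC : exists i, ~~ C (z + i * r) by exists i.
    (* The last point before the progression first leaves [C] is an end of [C]. *)
    case: (ex_minnP exC) => j nCj minj.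
    have jL : j < L by apply: leq_ltn_trans (minj _ nC) iL.
    case: j nCj minj jL => [|j nCj minj jL]; first by rewrite mul0n addn0 Cz.
    have j'L : j < L by apply: ltnW.
    rewrite add0n (bigD1 (Ordinal j'L)) //= /ends.
    have -> : C (z + j * r) by apply/negPn/negP => /minj; rewrite ltnn.
    by rewrite -addnA -mulSnr nCj.
  by rewrite leq_add2l; apply: leq_sum => i _; apply: cnt_shift_le.
have : L * (K * cnt (predI A C) n) <= L * (m * cnt C n + K * L * cnt (ends C r) n).
  have := leq_mul (leqnn K) sumstep; have := leq_mul (leqnn (K * L)) hE.
  have := leq_mul (leqnn (m * L)) cDC; lia.
by rewrite leq_pmul2l.
Qed.

(** * Popular differences *)

Lemma cnt_mul (A : pred nat) b M : cnt A (b * M) = \sum_(j < b) cnt (fun i => A (j * M + i)) M.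
Proof.
elim: b => [|b IH]; first by rewrite mul0n /cnt !big_ord0.
by rewrite mulSnr cntD IH big_ord_recr.
Qed.

(** The parameter [p] counts steps, not terms: [progs 1] is about pairs, [progs 2] about three-term
    progressions. *)
Definition progs (p : nat) (A : pred nat) (r : nat) : pred nat :=
  fun t => all (fun e => A (t + e * r)) (iota 0 p.+1).

Lemma progsP p (A : pred nat) r t : reflect (forall e, e <= p -> A (t + e * r)) (progs p A r t).
Proof.
by apply: (iffP allP) => h e; [move=> ep | rewrite mem_iota => /andP[_ ep]];
   apply: h; rewrite ?mem_iota.
Qed.

(* Cut into blocks of length M: each dense block contributes to some progs p A r, r < M. *)
Lemma popular_difference (p q M : nat) : 0 < p -> 0 < M ->
  (forall B : pred nat, supported B M -> M <= 2 * q * cnt B M ->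
     exists r t, 0 < r /\ progs p B r t) ->
  forall N (A : pred nat), 2 * M <= N -> supported A N -> N <= q * cnt A N ->
  exists r, [/\ 0 < r, r < M & N <= 4 * q * M ^ 2 * cnt (progs p A r) N].
Proof.
move=> p0 M0 hM N A leMN sA dA.
pose b := (N %/ M).+1.
have Nb : N <= b * M by rewrite /b mulSnr; have := divn_eq N M; have := ltn_pmod N M0; lia.
have bN : b * M <= N + M by rewrite /b mulSnr leq_add2r leq_divM.
have sP r : supported (progs p A r) N.
  by move=> t /progsP /(_ 0 isT); rewrite mul0n addn0 => /sA.
(* A block of density below [1 / (2 * q)] is paid for by the term [M]; in any other block the sum
   over [r] is at least 1 and the count of [A] at most [M]. *)
have block j : 2 * q * cnt (fun i => A (j * M + i)) M <=
    M + 2 * q * M * \sum_(r < M | 0 < r) cnt (fun i => progs p A r (j * M + i)) M.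
  pose B := fun i => A (j * M + i) && (i < M).
  have cB : cnt (fun i => A (j * M + i)) M = cnt B M.
    by apply: eq_bigr => i _; rewrite /B ltn_ord andbT.
  have sB : supported B M by move=> i /andP[].
  rewrite cB; case: (leqP M (2 * q * cnt B M)) => [/(hM B sB)|/ltnW]; last by lia.
  case=> r [t] [r0 /progsP pB].
  have tM : t < M by have /sB := pB 0 isT; rewrite mul0n addn0.
  have rM : r < M by have /sB := pB 1 p0; lia.
  have : 0 < \sum_(r < M | 0 < r) cnt (fun i => progs p A r (j * M + i)) M.
    rewrite (bigD1 (Ordinal rM)) //= /cnt (bigD1 (Ordinal tM)) //=.
    suff -> : progs p A r (j * M + t) by [].
    by apply/progsP => e /pB /andP[]; rewrite addnA.
  move=> s0; apply: leq_trans (leq_addl _ _).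
  by apply: leq_trans (leq_pmulr _ s0); rewrite leq_mul2l cnt_le_size orbT.
(* Summing over the blocks gives [2 * N] on the left and at most [N + M] in the first term. With
   [2 * M <= N] the sum over [r] is then at least [N / (4 * q * M)], and one of the [M] differences
   gets its share. *)
have total : N <= M + 2 * q * M * \sum_(r < M | 0 < r) cnt (progs p A r) N.
  have : 2 * q * cnt A (b * M) <=
      b * M + 2 * q * M * \sum_(r < M | 0 < r) cnt (progs p A r) (b * M).
    rewrite cnt_mul; under [in X in _ <= X]eq_bigr do rewrite cnt_mul.
    rewrite [X in _ + _ * X]exchange_big /= !big_distrr /=.
    have -> : b * M = \sum_(j < b) M by rewrite sum_nat_const card_ord.
    by rewrite -big_split; apply: leq_sum => j _; apply: block.
  rewrite (cnt_supported sA Nb).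
  have -> : \sum_(r < M | 0 < r) cnt (progs p A r) (b * M) =
      \sum_(r < M | 0 < r) cnt (progs p A r) N.
    by apply: eq_bigr => r _; rewrite (cnt_supported (sP _) Nb).
  lia.
case: (boolP [exists r : 'I_M, (0 < r) && (N <= 4 * q * M ^ 2 * cnt (progs p A r) N)]).
  by case/existsP=> r /andP[r0 hr]; exists r; split.
rewrite negb_exists => /forallP none.
suff : M * (4 * q * M * \sum_(r < M | 0 < r) cnt (progs p A r) N) <= M * N.-1.
  set s := \sum_(_ < _ | _) _ in total *.
  by rewrite leq_pmul2l //; lia.
have -> : M * N.-1 = \sum_(r < M) N.-1 by rewrite sum_nat_const card_ord.
rewrite big_mkcond !big_distrr /=.
apply: leq_sum => r _; case: ltnP => [r0|_]; last by rewrite !muln0.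
by move: (none r); rewrite r0 /= -ltnNge; nia.
Qed.

(** * Hilbert cubes and slow growth along their generators *)

Fixpoint subset_sums (xs : seq nat) : seq nat :=
  if xs is x :: ys then subset_sums ys ++ map (addn x) (subset_sums ys) else [:: 0].

(** Induction on [k]: for a popular difference [r], the points [t] with [t] and [t + r] in [B] are
    dense again, and a cube among them gains the generator [r]. The bound [W] does not depend on
    [n], so the generators are small compared with a long interval. *)
Lemma hilbert_cube k : forall q, 0 < q -> exists W n0, forall n (B : pred nat), n0 <= n ->
  supported B n -> n <= q * cnt B n ->
  exists c xs, [/\ size xs = k, {in xs, forall x, 0 < x <= W} &
                  {in subset_sums xs, forall s, B (c + s)}].
Proof.
elim: k => [|k IH] q q0.
  exists 0, 1 => n B n1 sB dB.
  case: (boolP [exists i : 'I_n, B i]) => [/existsP[c Bc]|].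
    by exists c, [::]; split=> // s; rewrite inE => /eqP ->; rewrite addn0.
  rewrite negb_exists => /forallP none; move: dB.
  rewrite /cnt big1 ?muln0; first by lia.
  by move=> i _; rewrite (negbTE (none i)).
(* As [M > 2 * q], a set of density [1 / (2 * q)] below [M] has two elements. *)
pose M := (2 * q).+1 * 2.
have hM B : supported B M -> M <= 2 * q * cnt B M ->
     exists r t, 0 < r /\ progs 1 B r t.
  move=> sB dB.
  have : ~~ [forall i : 'I_M, forall j : 'I_M, B i ==> B j ==> (i == j)].
    apply/negP => /forallP uB; suff : cnt B M <= 1 by rewrite /M in dB *; nia.
    case: (boolP [exists i : 'I_M, B i]) => [/existsP[c Bc]|].
      rewrite /cnt (bigD1 c) //= big1 ?addn0 ?leq_b1 // => i ic.
      have /forallP/(_ i) := uB c; rewrite Bc /=.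
      by case: (B i) => //= /eqP ci; rewrite ci eqxx in ic.
    rewrite negb_exists => /forallP none.
    by rewrite /cnt big1 // => i _; rewrite (negbTE (none i)).
  rewrite negb_forall => /existsP[i]; rewrite negb_forall => /existsP[j].
  rewrite !negb_imply => /and3P[Bi Bj nij].
  wlog lt_ij : i j Bi Bj nij / i < j.
    move=> wl; case: (ltngtP i j) => [||/val_inj eij]; first exact: wl.
      by apply: wl => //; rewrite eq_sym.
    by rewrite eij eqxx in nij.
  exists (j - i), i; split; first by lia.
  apply/progsP => [[|[|//]]] _; rewrite ?mul0n ?addn0 // mul1n subnKC //; exact: ltnW.
have q'0 : 0 < 4 * q * M ^ 2 by rewrite /M; nia.
have [W [n0 hW]] := IH _ q'0.
exists (maxn W M), (maxn n0 (2 * M)) => n B; rewrite geq_max => /andP[n0n Mn] sB dB.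
have [||r [r0 rM dr]] := popular_difference _ _ hM Mn sB dB => //.
have sr : supported (progs 1 B r) n.
  by move=> t /progsP /(_ 0 isT); rewrite mul0n addn0 => /sB.
have [c [xs [sz bx hc]]] := hW n _ n0n sr dr.
exists c, (r :: xs); split=> /=; first by rewrite sz.
- by move=> x; rewrite inE => /predU1P[->|/bx]; lia.
- move=> s; rewrite mem_cat => /orP[/hc|/mapP[s' /hc hs ->]].
    by move/progsP/(_ 0 isT); rewrite mul0n addn0.
  by move/progsP: hs => /(_ 1 isT); rewrite mul1n; congr (is_true (B _)); lia.
Qed.

(** Compare [f] on successive suffixes of [xs]: either some step gains at most [X], or each of the
    [size xs] steps gains at least [X.+1]. *)
Lemma slow_step (f : seq nat -> nat) (X : nat) (xs : seq nat) :
  (exists x ys, [/\ x \in xs, {subset subset_sums (x :: ys) <= subset_sums xs} &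
                   f (x :: ys) <= f ys + X]) \/
  f [::] + size xs * X.+1 <= f xs.
Proof.
elim: xs => [|x xs [[y [ys [yxs sub le_f]]]|IH]].
- by right; rewrite mul0n addn0.
- left; exists y, ys; split=> //; first by rewrite inE yxs orbT.
  by move=> s /sub ss; rewrite /= mem_cat ss.
- case: (leqP (f (x :: xs)) (f xs + X)) => [le_f|lt_f]; last by right => /=; lia.
  by left; exists x, xs; split=> //; rewrite inE eqxx.
Qed.

(** * Reflecting a set in the points of a cube *)

(** These are the points [z] completing a progression [a, c + s, z] with [a] in [A]. The guard keeps
    the truncated subtraction exact. *)
Definition reflections (A : pred nat) (c : nat) (ys : seq nat) : pred nat :=
  fun z => has (fun s => (z <= 2 * (c + s)) && A (2 * (c + s) - z)) (subset_sums ys).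

Lemma reflections_cons (A : pred nat) c x ys z :
  reflections A c ys z -> reflections A c (x :: ys) z.
Proof. by rewrite /reflections /= has_cat => ->. Qed.

(** Moving the centre of a reflection by [x] moves the image by [2 * x]. *)
Lemma reflections_cons_shift (A : pred nat) c x ys z :
  reflections A c ys z -> reflections A c (x :: ys) (z + 2 * x).
Proof.
case/hasP=> s ss /andP[le_z Az]; apply/hasP; exists (x + s).
  by rewrite /= mem_cat map_f ?orbT.
rewrite (_ : 2 * (c + (x + s)) = 2 * (c + s) + 2 * x); last by lia.
by rewrite leq_add2r le_z subnDr.
Qed.

Lemma cnt_reflections_nil (A : pred nat) H c n : supported A H ->
  H <= (2 * c).+1 -> 2 * c < n -> cnt A H <= cnt (reflections A c [::]) n.
Proof.
move=> sA le_H lt_n.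
rewrite -(cnt_supported sA le_H) -(subnKC lt_n) cntD; apply: leq_trans (leq_addr _ _).
rewrite /cnt (reindex_inj rev_ord_inj) /=; apply: leq_sum => i _.
rewrite /reflections /= addn0 orbF subSS.
by have := ltn_ord i; rewrite ltnS => ->.
Qed.

Lemma cnt_tail_le n r : cnt (fun z => n <= z + r) n <= r.
Proof.
case: (leqP r n) => [le_rn|/ltnW]; last by apply: leq_trans; apply: cnt_le_size.
rewrite -{2}(subnK le_rn) cntD [X in X + _]big1 => [|i _]; first exact: cnt_le_size.
by apply/eqP; rewrite eqb0; have := ltn_ord i; lia.
Qed.

Lemma cnt_predC (S : pred nat) n : cnt (predC S) n + cnt S n = n.
Proof.
rewrite /cnt -big_split /= -[RHS]card_ord -sum1_card.
by apply: eq_bigr => i _; case: (S i).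
Qed.

(* S and S - r have the same size. *)
Lemma cnt_starts (S : pred nat) r n : supported S n -> (forall z, S z -> r <= z) ->
  cnt (fun z => ~~ S z && S (z + r)) n = cnt (ends S r) n.
Proof.
move=> sS geS.
have : cnt S n = cnt (fun z => S (z + r)) n.
  rewrite /cnt -(@sum_shift (fun z => nat_of_bool (S (z + r))) r) => [|z le_n].
    apply: eq_bigr => y _; case: (leqP r y) => [le_ry|lt_yr]; first by rewrite subnK // mul1n.
    by apply/eqP; rewrite mul0n eqb0; apply/negP => /geS; lia.
  by apply/eqP; rewrite eqb0; apply/negP => /sS; lia.
have : cnt (fun z => ~~ S z && S (z + r)) n + cnt S n =
       cnt (ends S r) n + cnt (fun z => S (z + r)) n.
  rewrite /cnt -!big_split; apply: eq_bigr => z _; rewrite /ends /=.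
  by case: (S z); case: (S _).
lia.
Qed.

(** * Roth's theorem *)

Definition AP3_free (A : pred nat) : Prop := forall r t, 0 < r -> ~~ progs 2 A r t.

Lemma AP3_freeP (A : pred nat) x y z : AP3_free A -> x < y -> x + z = 2 * y ->
  A x -> A y -> A z -> False.
Proof.
move=> fA lt_xy eq_xz Ax Ay Az.
have /negP := fA (y - x) x ltac:(lia); apply; apply/progsP => [[|[|[|//]]]] _.
- by rewrite mul0n addn0.
- by rewrite mul1n subnKC // ltnW.
- by rewrite (_ : x + _ = z) //; lia.
Qed.

Lemma AP3_free_prog (A : pred nat) a r : 0 < r -> AP3_free A ->
  AP3_free (fun i => A (a + i * r)).
Proof.
move=> r0 fA s t s0; apply/negP => /progsP h.
have /negP := fA (s * r) (a + t * r) ltac:(by rewrite muln_gt0 s0).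
apply; apply/progsP => e /h.
by rewrite mulnDl addnA mulnA.
Qed.

(** This is [window_bound] for the interval below [n] and [r = 1]; an interval has at most one end,
    whence the error [K * L]. *)
Lemma AP3_free_bound (K m L : nat) : 0 < L ->
  (forall A, AP3_free A -> K * cnt A L <= m * L) ->
  forall A n, AP3_free A -> K * cnt A n <= m * n + K * L.
Proof.
move=> L0 hL A n fA; pose C := fun z => z < n.
have := @window_bound A C K m L 1 n L0 (fun z => hL _ (AP3_free_prog _ _ fA)) (fun _ => id).
move=> /(_ isT).
have -> : cnt (predI A C) n = cnt A n.
  by apply: eq_bigr => i _; rewrite /C /= ltn_ord andbT.
have -> : cnt C n = n.
  rewrite -[RHS](cnt_predC C) /cnt [X in _ = X + _]big1 // => i _.
  by rewrite /C /= ltn_ord.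
have : cnt (ends C 1) n <= 1.
  apply: leq_trans (cnt_tail_le n 1); apply: sub_cnt => z _ /andP[_].
  by rewrite /C -leqNgt.
nia.
Qed.

(** One length [L] is enough to record the density bound [m / K], since [AP3_free_bound] carries it
    to all lengths. *)
Definition AP3_free_sparse (K m : nat) : Prop :=
  exists2 L, 0 < L & forall A, AP3_free A -> K * cnt A L < m * L.

(* Reflect A below H in the points of a Hilbert cube of A above H. The reflected sets grow
   with the cube and avoid A, so one of them, S, is almost invariant under some shift
   r = 2 x; then the complement of S is almost a union of long r-progressions, and A cannot
   be as dense on them as it would have to be. *)
Lemma roth_step q m : 0 < q -> 64 * q <= m ->
  AP3_free_sparse (64 * q ^ 2) m.+1 -> AP3_free_sparse (64 * q ^ 2) m.
Proof.
move=> q0 le_qm [L L0 hL]; set K := 64 * q ^ 2 in hL *.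
have K0 : 0 < K by rewrite muln_gt0 expn_gt0 q0.
have bound := AP3_free_bound L0 (fun A fA => ltnW (hL A fA)).
have k0 : 0 < K * L by rewrite muln_gt0 K0.
have q20 : 0 < 2 * q by rewrite muln_gt0.
have [W [n0 cube]] := hilbert_cube (K * L) q20.
(* [H] is long enough for the cube lemma and makes the errors [2 * K * L] and [K * L * r], with
   [r <= 2 * W], at most [H]. *)
pose H := (n0 + 2 * (K * L * W) + 2 * (K * L)).+1.
exists (4 * H) => // A fA; rewrite ltnNge; apply/negP => dA.
have WH : 2 * W <= H by rewrite /H; nia.
have KLH : 2 * (K * L) <= H by rewrite /H; lia.
have KLWH : 2 * (K * L * W) <= H by rewrite /H; lia.
have n0H : n0 <= H by rewrite /H; lia.
have H0 : 0 < H by [].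
clearbody H.
have fS a : AP3_free (fun i => A (a + i)).
  by move=> r t r0; have := AP3_free_prog a (isT : 0 < 1) fA t r0;
     rewrite /progs /= !muln1.
have b1 := bound A H fA.
have b2 := bound _ H (fS H).
have b3 := bound _ (2 * H) (fS (2 * H)).
have split4 : cnt A (4 * H) =
    cnt A H + cnt (fun i => A (H + i)) H + cnt (fun i => A (2 * H + i)) (2 * H).
  by rewrite (_ : 4 * H = H + H + 2 * H) ?cntD ?addnn -?mul2n //; lia.
have mH : 64 * H <= m * H by rewrite leq_mul2r (leq_trans _ le_qm) ?orbT //; lia.
have qmH : 64 * q * H <= m * H by rewrite leq_mul2r le_qm orbT.
have half a : m * H <= 2 * (K * a) -> H <= 2 * q * a.
  move=> le_a; suff : 64 * q * H <= 64 * q * (2 * q * a) by rewrite leq_pmul2l ?muln_gt0.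
  by apply: leq_trans qmH (leq_trans le_a _); rewrite /K; lia.
(* The set has density at least [m / K] below [4 * H], while each piece has density at most
   [m.+1 / K] up to a small error. Hence the first two quarters each have density at least
   [m / (2 * K) >= 1 / (2 * q)]. *)
have d1 : H <= 2 * q * cnt A H.
  by apply: half; move: dA; rewrite split4; lia.
have d2 : H <= 2 * q * cnt (fun i => A (H + i)) H.
  by apply: half; move: dA; rewrite split4; lia.
pose B := fun i => A (H + i) && (i < H).
have cB : cnt B H = cnt (fun i => A (H + i)) H.
  by apply: eq_bigr => i _; rewrite /B ltn_ord andbT.
rewrite -cB in d2.
have sB : supported B H by move=> i /andP[].
have [c [xs [szx bx hc]]] := cube H B n0H sB d2.
pose A1 := fun x => A x && (x < H).
have sA1 : supported A1 H by move=> i /andP[].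
have cA1 : cnt A1 H = cnt A H by apply: eq_bigr => i _; rewrite /A1 ltn_ord andbT.
pose T := reflections A1 (H + c).
(* A reflected point is the third term of a progression with first term in [A] below [H] and middle
   term in [A] between [H] and [2 * H]. *)
have TP ys z : {subset subset_sums ys <= subset_sums xs} -> T ys z ->
    [/\ H <= z, z < 4 * H & ~~ A z].
  move=> sub /hasP[s /sub /hc /andP[As cs] /andP[le_z /andP[Az ltH]]].
  split; [lia|lia|apply/negP => A'z].
  by apply: (@AP3_freeP A _ (H + c + s) z fA _ _ Az _ A'z); rewrite ?addnA //; try lia;
     rewrite -addnA.
(* Gains above [4 * H %/ (K * L)] at all [K * L] steps would exceed the available [4 * H] points. *)
have [|] := slow_step (fun ys => cnt (T ys) (4 * H)) (4 * H %/ (K * L)) xs; last first.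
  rewrite szx => le_cnt; have := cnt_le_size (T xs) (4 * H).
  have := ltn_ceil (4 * H) k0; lia.
case=> x [ys [xxs sub gap]].
have suby : {subset subset_sums ys <= subset_sums xs}.
  by move=> s ss; apply: sub; rewrite /= mem_cat ss.
have /andP[x0 xW] := bx _ xxs.
pose r := 2 * x; pose S := T ys.
have sS : supported S (4 * H) by move=> z /(TP _ _ suby)[].
have cS : H <= 2 * q * cnt S (4 * H).
  apply: leq_trans d1 _; rewrite -cA1 leq_mul2l; apply/orP; right.
  have /hc/sB : 0 \in subset_sums xs.
    by apply: suby; elim: {+}ys => //= y l IH; rewrite mem_cat IH.
  move=> cH; apply: leq_trans (_ : cnt (T [::]) (4 * H) <= _).
    by apply: cnt_reflections_nil => //; lia.
  apply: sub_cnt => z _; rewrite /S /T; elim: {+}ys => // y l IH /IH.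
  exact: reflections_cons.
(* The ends of [S], shifted by [r], are new points of [T (x :: ys)]. *)
have gapS : cnt (ends S r) (4 * H) <= 4 * H %/ (K * L).
  pose D := fun z => T (x :: ys) z && ~~ S z.
  have sD : supported D (4 * H) by move=> z /andP[/(TP _ _ sub)[]].
  have le_D : cnt (ends S r) (4 * H) <= cnt D (4 * H).
    apply: leq_trans (cnt_shift_le r sD); apply: sub_cnt => z _ /andP[Sz nSz].
    by rewrite /D nSz andbT; apply: reflections_cons_shift.
  have : cnt D (4 * H) + cnt S (4 * H) = cnt (T (x :: ys)) (4 * H).
    rewrite /cnt -big_split; apply: eq_bigr => z _; rewrite /D /=.
    have := @reflections_cons A1 (H + c) x ys z; rewrite -/T -/S.
    by case: (S z) => [->|_] //; rewrite andbT addn0.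
  move: gap le_D; rewrite -/S; lia.
pose C := fun z => (z < 4 * H) && ~~ S z.
have sC : supported C (4 * H) by move=> z /andP[].
have r0 : 0 < r by rewrite /r; lia.
have := window_bound L0 (fun z => ltnW (hL _ (AP3_free_prog z r0 fA))) sC.
have -> : cnt (predI A C) (4 * H) = cnt A (4 * H).
  apply: eq_bigr => z _; rewrite /= /C ltn_ord /=.
  by case: (boolP (S z)) => [/(TP _ _ suby)[_ _ /negbTE ->]|_]; rewrite ?andbT.
have cC : cnt C (4 * H) + cnt S (4 * H) = 4 * H.
  rewrite -[RHS](cnt_predC S); congr (_ + _).
  by apply: eq_bigr => z _; rewrite /C ltn_ord.
(* An end of [C] either lies within [r] of [4 * H] or steps into [S]; the latter are as many as the
   ends of [S]. *)
have eC : cnt (ends C r) (4 * H) <= r + 4 * H %/ (K * L).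
  apply: leq_trans (leq_add (cnt_tail_le (4 * H) r) gapS).
  rewrite -(cnt_starts sS) => [|z /(TP _ _ suby)[? _ _]]; last by rewrite /r; lia.
  rewrite /cnt -big_split; apply: leq_sum => z _; rewrite /ends /C ltn_ord /= negb_and negbK.
  by rewrite -leqNgt; case: (S z) => //=; case: (4 * H <= z + r) => //=; case: (S _).
have hgap := leq_divM (4 * H) (K * L).
have rH : K * L * r <= H.
  by apply: leq_trans KLWH; rewrite /r mulnCA leq_mul2l leq_mul2l xW orbT.
move: (cnt S _) (cnt C _) (cnt (ends C r) _) (4 * H %/ (K * L)) eC cS cC hgap => s t e g.
move=> le_e le_s st hgap hA.
have le_KLe : K * L * e <= H + 4 * H.
  apply: leq_trans (leq_mul (leqnn _) le_e) _.
  by rewrite mulnDr leq_add // mulnC.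
have ms : 64 * q * s <= m * s by rewrite leq_mul2r le_qm orbT.
(* Replacing [m] by [m.+1] costs [4 * H] and the ends of [C] cost [5 * H], but leaving out [S] saves
   [m.+1 * s >= 64 * q * s >= 32 * H], contradicting [dA]. *)
have : m.+1 * t + m.+1 * s = m.+1 * (4 * H) by rewrite -mulnDr st.
lia.
Qed.

(** The descent starts at [m = K.+1], where the bound is trivial with [L = 1], and lowers [m] by one
    until [m / K] is [1 / q]. *)
Lemma roth q : 0 < q -> AP3_free_sparse (64 * q ^ 2) (64 * q).
Proof.
move=> q0; set K := 64 * q ^ 2.
have le_K : 64 * q <= K by rewrite leq_mul2l; apply: leq_pmull.
have start : AP3_free_sparse K K.+1.
  exists 1 => // A _; have := cnt_le_size A 1; rewrite muln1 ltnS.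
  by rewrite -{2}[K]muln1 leq_mul2l orbC => ->.
have descend j : 64 * q + j <= K.+1 -> AP3_free_sparse K (K.+1 - j).
  elim: j => [|j IH] le_j; first by rewrite subn0.
  apply: roth_step => //; first by lia.
  by rewrite -subSn ?subSS; [apply: IH; lia | lia].
have -> : 64 * q = K.+1 - (K.+1 - 64 * q) by lia.
by apply: descend; lia.
Qed.

(** * Building configurations *)

(** The parameters increase, so that the largest one, from which the next is formed, is the last. *)
Definition has_configuration (d : nat) (A : pred nat) : Prop :=
  exists a (n : nat -> nat), [/\ 0 < a, forall i, i < d -> 0 < n i,
    forall i j, i < j < d -> n i < n j &
    forall i j, i <= j < d -> A (n i + n j + a)].

(** The sums with the new parameter are [n i + n d.-1 + r] and [2 * n d.-1 + 2 * r]: with [a] added,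
    second and third terms of progressions that start at old elements. *)
Lemma has_configurationS d (A : pred nat) r : 0 < r -> 0 < d ->
  has_configuration d (progs 2 A r) -> has_configuration d.+1 A.
Proof.
move=> r0 d0 [a [n [a0 n0 incr hA]]].
have hP i j e : i <= j < d -> e <= 2 -> A (n i + n j + a + e * r).
  by move=> /hA /progsP; apply.
exists a, (fun i => if i < d then n i else n d.-1 + r); split=> //.
- by move=> i _; case: (ltnP i d) => [/n0//|_]; rewrite ltn_addl.
- move=> i j /andP[lt_ij]; rewrite ltnS leq_eqVlt => /predU1P[ej|lt_jd].
    rewrite ej ltnn; rewrite ej in lt_ij; rewrite lt_ij.
    have: n i <= n d.-1; last by lia.
    case: (ltngtP i d.-1) => [lt_i|lt_i|-> //]; last by lia.
    by apply: ltnW; apply: incr; lia.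
  by rewrite lt_jd (ltn_trans lt_ij lt_jd); apply: incr; rewrite lt_ij.
- move=> i j /andP[le_ij le_jd].
  case: (ltnP j d) => [lt_jd|le_dj].
    rewrite (leq_ltn_trans le_ij lt_jd).
    by have := hP i j 0; rewrite mul0n addn0; apply; rewrite ?le_ij.
  case: (ltnP i d) => [lt_id|le_di].
    have := hP i d.-1 1 ltac:(lia) isT; congr (is_true (A _)); lia.
  have := hP d.-1 d.-1 2 ltac:(lia) isT; congr (is_true (A _)); lia.
Qed.

Lemma dense_has_configuration d : forall q, 0 < q ->
  exists N0, forall N (A : pred nat), N0 <= N -> supported A N ->
    N <= q * cnt A N -> has_configuration d.+1 A.
Proof.
elim: d => [|d IH] q q0.
  (* A set of density [1 / q] below some [N > 3 * q] has more than three elements, hence an element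
     [x >= 3]; then [x = 1 + 1 + (x - 2)] with [x - 2] positive. *)
  exists (3 * q).+1 => N A ltN sA dA.
  have : ~~ [forall x : 'I_N, A x ==> (x < 3)].
    apply/negP => /forallP small.
    have s3 : supported A 3.
      by move=> i Ai; have /implyP := small (Ordinal (sA _ Ai)); apply.
    have c3 : cnt A N <= 3.
      have s3' : supported A (minn 3 N) by move=> i Ai; rewrite leq_min s3 // sA.
      rewrite (cnt_supported s3') ?geq_minr //.
      by apply: leq_trans (cnt_le_size _ _) (geq_minl _ _).
    have := leq_mul (leqnn q) c3; lia.
  rewrite negb_forall => /existsP[x]; rewrite negb_imply -leqNgt => /andP[Ax x3].
  exists (x - 2), (fun=> 1); split=> //; first by lia.
    by move=> i j; lia.
  by move=> i j _; rewrite (_ : 1 + 1 + (x - 2) = x) //; lia.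
have q20 : 0 < 2 * q by rewrite muln_gt0.
(* Roth's theorem is taken at density [1 / (2 * q)], the one required of blocks in
   [popular_difference]. *)
have [M M0 hM] := roth q20.
have pattern (B : pred nat) : supported B M -> M <= 2 * q * cnt B M ->
    exists r t, 0 < r /\ progs 2 B r t.
  move=> sB dB.
  case: (boolP [exists r : 'I_M, exists t : 'I_M, (0 < r) && progs 2 B r t]).
    by case/existsP=> r /existsP[t /andP[r0 pB]]; exists r, t.
  move=> none; suff /hM : AP3_free B.
    by have := leq_mul (leqnn (64 * (2 * q))) dB; lia.
  move=> r t r0; apply: contra none => pB; have /progsP hB := pB.
  have tM : t < M by have /sB := hB 0 isT; lia.
  have rM : r < M by have /sB := hB 1 isT; lia.
  by apply/existsP; exists (Ordinal rM); apply/existsP; exists (Ordinal tM); rewrite r0.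
have q'0 : 0 < 4 * q * M ^ 2 by rewrite !muln_gt0 q0 M0.
have [N0 hN0] := IH _ q'0.
exists (maxn N0 (2 * M)) => N A; rewrite geq_max => /andP[N0N MN] sA dA.
have [r [r0 _ dr]] := popular_difference (isT : 0 < 2) M0 pattern MN sA dA.
apply: (has_configurationS r0) => //; apply: hN0 N0N _ dr.
by move=> t /progsP /(_ 0 isT); rewrite mul0n addn0 => /sA.
Qed.

(** * From real density to natural numbers *)

Local Open Scope fset_scope.
Local Open Scope ring_scope.

Theorem theorem1p2 (R : realType) (alpha : R) (d : nat)
    (halpha : 0 < alpha < 1) (hd : (1 <= d)%N) :
  exists N0 : nat, forall N : nat, (N0 <= N)%N ->
    forall A : {fset nat},
      (forall k : nat, k \in A -> (1 <= k <= N)%N) ->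
      alpha * N%:R <= #|` A|%:R ->
      contains_nontrivial_configuration d A.
Proof.
case: d hd => // d _; have /andP[alpha0 _] := halpha.
(* The factor 2 absorbs the passage from [N] to [N.+1], the length of the range [0, ..., N]; taking
   [N0.+1] below ensures [N >= 1], so that [N.+1 <= 2 * N]. *)
pose q := (2 * Num.bound alpha^-1)%N.
have le_q : 2 <= q%:R * alpha.
  rewrite natrM -mulrA ler_peMr // -ler_pdivrMr // mul1r ltW //.
  by apply: archi_boundP; rewrite invr_ge0 ltW.
have q0 : (0 < q)%N.
  by case: (posnP q) le_q => // ->; rewrite mul0r lern0.
clearbody q; have [N0 hN0] := dense_has_configuration d q0.
exists N0.+1 => N ltN A hA dA.
pose P : pred nat := fun k => k \in A.
have sP : supported P N.+1 by move=> k /hA /andP[_]; rewrite ltnS.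
have cP : cnt P N.+1 = #|` A|.
  rewrite /cnt -(big_mkord xpredT (fun i => nat_of_bool (P i))).
  have -> : (\sum_(0 <= i < N.+1) P i = count P (index_iota 0 N.+1))%N.
    by rewrite -sum1_count [RHS]big_mkcond; apply: eq_bigr => i _; case: (P i).
  rewrite -size_filter; apply/perm_size/uniq_perm; rewrite ?fset_uniq ?filter_uniq ?iota_uniq //.
  move=> k; rewrite mem_filter mem_index_iota /=; apply: andb_idr => /sP; lia.
have [|||a [n [a0 n0 incr hP]]] := hN0 N.+1 P => //.
- exact: leqW (ltnW ltN).
- rewrite cP; have : (2 * N <= q * #|` A|)%N; last by lia.
  rewrite -(ler_nat R) !natrM; apply: le_trans (_ : q%:R * alpha * N%:R <= _).
    by rewrite ler_wpM2r.
  by rewrite -mulrA ler_wpM2l.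
exists a, (fun i => n i); split=> //.
- by move=> i; apply: n0.
- move=> i j eij; apply: val_inj; case: (ltngtP i j) => // lt_ij.
    by have := incr i j; rewrite lt_ij ltn_ord eij ltnn => /(_ isT).
  by have := incr j i; rewrite lt_ij ltn_ord eij ltnn => /(_ isT).
apply/fsubsetP => x /imfsetP[[i j] /= le_ij ->].
by apply: hP; rewrite ltn_ord andbT; exact: le_ij.
Qed.
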